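(* Let $X$ be an Abelian group, and let $f, g : X\to\mathbb{C}$ be functions that do not vanish at any point of $X$ and satisfy the Hermitian condition $f(-x)=\overline{f(x)}$, $g(-x)=\overline{g(x)}$ for all $x\in X$. Suppose that $f$ and $g$ satisfy the Kac--Bernstein functional equation $$f(x+y)\,g(x-y)=f(x)f(y)g(x)g(-y)\quad\text{for all } x,y\in X.$$ Then there exist functions $\alpha,\beta : X\to\mathbb{C}$, $a,b : X\to\{1,-1\}$ and $P,r : X\to\mathbb{R}$ such that $$f(x)=\alpha(x)a(x)\exp\{P(x)+r(x)\},\qquad g(x)=\beta(x)b(x)\exp\{P(x)-r(x)\}\quad\text{for all } x\in X,$$ where: (i) $\alpha(x+y)=\alpha(x)\alpha(y)$, $\beta(x+y)=\beta(x)\beta(y)$ for all $x,y\in X$, and $|\alpha(x)|=|\beta(x)|=1$ for all $x\in X$; (ii) $a$ and $b$ are constant on each coset of the subgroup $X^{(4)}$ in $X$; (iii) $P(x+y)+P(x-y)=2[P(x)+P(y)]$ for all $x,y\in X$; (iv) $r$ is constant on each coset of the subgroup $X^{(2)}$ in $X$.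
   Context: For an Abelian group $X$ (written additively) and a positive integer $n$, $X^{(n)}=\{nx : x\in X\}$ denotes the image of $X$ under the map $x\mapsto nx$. No topology is placed on $X$. *)

(* Defs.v *)
From mathcomp Require Import all_boot all_order all_algebra.
From mathcomp Require Import classical_sets reals complex.

Set Implicit Arguments.
Unset Strict Implicit.
Unset Printing Implicit Defensive.

Import Order.TTheory GRing.Theory Num.Theory.

Local Open Scope classical_set_scope.
Local Open Scope ring_scope.

Definition multiples (X : zmodType) (n : nat) : set X :=
  [set x *+ n | x in [set: X]].

Arguments multiples : clear implicits.

Definition coset_by (X : zmodType) (H : set X) (c : X) : set X :=
  [set c + h | h in H].

Definition constant_on_cosets (X : zmodType) (T : Type) (H : set X)
    (h : X -> T) : Prop :=
  forall c x y : X, coset_by H c x -> coset_by H c y -> h x = h y.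

Definition hermitian_fun (R : realType) (X : zmodType) (f : X -> R[i]) : Prop :=
  forall x : X, f (- x) = Num.conj (f x).

Definition kac_bernstein (R : realType) (X : zmodType) (f g : X -> R[i]) :
    Prop :=
  forall x y : X, f (x + y) * g (x - y) = f x * f y * g x * g (- y).

(* Main.v *)
(* Write [f = F * `|f|] and [g = G * `|g|].  The logarithms of the moduli satisfy
   an additive Kac-Bernstein equation; adding to it, resp. subtracting from it,
   its image under [y -> - y] gives [P], resp. [r].  For the phases, multiplying
   the equations at [(x, y)] and [(y, x)] shows that [F ^+ 2] is a character.  It
   is trivial on elements of order 2, where [F] is real, so it is the square of a
   character [alpha], and [a := F / alpha] is a sign.  Since the equation also
   forces [F (x + 4y) = F x * F y ^+ 4 = F x * alpha (4y)], [a] is constant on the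
   cosets of [X^(4)]. *)
Require Import Defs.
From mathcomp Require Import all_boot all_order all_algebra ring lra.
From mathcomp Require Import boolp classical_sets reals complex sequences exp.

Set Implicit Arguments.
Unset Strict Implicit.
Unset Printing Implicit Defensive.

Import Order.TTheory GRing.Theory Num.Theory.
Local Open Scope complex_scope.
Local Open Scope ring_scope.

(* The set [S] below is the graph of a partial square root of [chi]; once it is
   nonempty, its domain is a subgroup containing [2X].  A maximal such graph is
   total: if [x] is not in the domain, then [x -> F x] extends it, because
   [2x] is in the domain and is already sent to [chi x = F x ^+ 2]. *)
Lemma sqrt_character (K : fieldType) (X : zmodType) (F : X -> K) :
  (forall x, F x != 0) ->
  (forall x y, F (x + y) ^+ 2 = F x ^+ 2 * F y ^+ 2) ->
  (forall x, x + x = 0 -> F x ^+ 2 = 1) ->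
  exists alpha : X -> K, (forall x y, alpha (x + y) = alpha x * alpha y) /\
                         (forall x, alpha x ^+ 2 = F x ^+ 2).
Proof.
move=> Fn0; pose chi x := F x ^+ 2; rewrite -/chi => chiD' chi_tor.
have chiD x y : chi (x + y) = chi x * chi y by exact: chiD'.
have chin0 x : chi x != 0 by rewrite expf_neq0.
have chiV x : chi x * chi (- x) = 1.
  by rewrite -chiD subrr; apply: chi_tor; rewrite addr0.
(* No clause asks for nonemptiness, because the union of the empty chain must qualify too. The last
   clause, stated only at [0], is what makes the relation single-valued. *)
pose ok (S : set (X * K)) :=
  [/\ forall x y z w, S (x, z) -> S (y, w) -> S (x + y, z * w),
      forall x y z, S (x, z) -> S (x + (y + y), z * chi y) &
      forall z, S (0, z) -> z = 1].
have [C Cok Ctot|S [[Smul Schi S1] Smax]] := @Zorn_bigcup _ ok.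
  split=> [x y z w [A CA Axz] [B CB Byw]|x y z [A CA Axz]|z [A CA Az]].
  - have [AB|BA] := Ctot _ _ CA CB.
      by exists B => //; have [h _ _] := Cok _ CB; apply: h => //; exact: AB.
    by exists A => //; have [h _ _] := Cok _ CA; apply: h => //; exact: BA.
  - by exists A => //; have [_ h _] := Cok _ CA; exact: h.
  - by have [_ _ h] := Cok _ CA; exact: h.
(* Doubling a pair [(x, z)] and translating by [-2x] lands over [0]. An empty [S] is not maximal:
   the graph of [2y -> chi y] properly contains it. *)
have S01 : S (0, 1).
  suff [p Sp] : exists p, S p.
    case: p Sp => x z Sxz.
    have := Schi _ (- x) _ (Smul _ _ _ _ Sxz Sxz).
    by rewrite -opprD subrr => Sz; rewrite -(S1 _ Sz).
  apply: contrapT => S0.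
  pose B : set (X * K) := [set p | exists y, p = (y + y, chi y)]%classic.
  apply: (Smax B); first split=> [|BS].
  - by move=> p Sp; case: S0; exists p.
  - by apply: S0; exists (0 + 0, chi 0); apply: BS; exists 0.
  split=> [x y z w [u [-> ->]] [v [-> ->]]|x y z [u [-> ->]]|z [u [u0 ->]]].
  - by exists (u + v); rewrite chiD addrACA.
  - by exists (u + y); rewrite chiD addrACA.
  - exact: chi_tor.
(* With [w = z] this is the square root property; comparing two values over [x], it makes them
   equal, whence multiplicativity below. *)
have Suniq x z w : S (x, z) -> S (x, w) -> z * w = chi x.
  move=> Sz Sw; have := Schi _ (- x) _ (Smul _ _ _ _ Sz Sw).
  rewrite -opprD subrr => /S1 zw.
  by apply: (mulIf (chin0 (- x))); rewrite zw chiV.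
have Stotal x : exists z, S (x, z).
  apply: contrapT => Sx.
  pose T : set (X * K) :=
    [set p | S p \/ exists y z, S (y, z) /\ p = (y + x, z * F x)]%classic.
  apply: (Smax T); first split=> [p Sp|TS]; first by left.
    apply: Sx; exists (F x); apply: TS; right.
    by exists 0, 1; rewrite add0r mul1r.
  split=> [y y' z z'|y y' z|z].
  - case=> [Sy|[u [v [Su [-> ->]]]]] [Sy'|[u' [v' [Su' [-> ->]]]]].
    + by left; exact: Smul.
    + right; exists (y + u'), (z * v'); split; first exact: Smul.
      by rewrite addrA mulrA.
    + right; exists (u + y'), (v * z'); split; first exact: Smul.
      by rewrite addrAC mulrAC.
    + left; have := Schi _ x _ (Smul _ _ _ _ Su Su').
      by rewrite /chi expr2 addrACA mulrACA.
  - case=> [Sy|[u [v [Su [-> ->]]]]]; first by left; exact: Schi.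
    right; exists (u + (y' + y')), (v * chi y'); split; first exact: Schi.
    by rewrite addrAC mulrAC.
  (* A new pair over [0] would have [u = - x]; translating [(- x, v)] by [2x] would then put [x] in
     the domain of [S]. *)
  - case=> [/S1 //|[u [v [Su [/esym/eqP]]]]].
    rewrite addr_eq0 => /eqP u_eq _; case: Sx; exists (v * chi x).
    by have := Schi _ x _ Su; rewrite u_eq addrA addNr add0r.
have [alpha Salpha] := choice Stotal; exists alpha.
have alpha2 x : alpha x ^+ 2 = chi x by rewrite expr2; exact: Suniq.
split=> // x y; have an0 : alpha (x + y) != 0.
  by rewrite -sqrf_eq0 alpha2.
apply: (mulfI an0); rewrite -expr2 alpha2; apply/esym/Suniq => //.
exact: Smul.
Qed.

(** The Kac-Bernstein equation for phases, with [G (- y)] already written as [(G y)^-1]; free of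
    conjugation, it makes sense over any field. *)
Definition unit_kac_bernstein (K : fieldType) (X : zmodType) (F G : X -> K) :=
  forall x y, F (x + y) * G (x - y) = F x * F y * G x * (G y)^-1.

(** Replacing [y] by [- y] exchanges the roles of [F] and [G]. *)
Lemma unit_kac_bernstein_sym (K : fieldType) (X : zmodType) (F G : X -> K) :
  (forall x, F (- x) = (F x)^-1) -> (forall x, G (- x) = (G x)^-1) ->
  unit_kac_bernstein F G -> unit_kac_bernstein G F.
Proof.
move=> FN GN FG x y; have := FG x (- y).
by rewrite opprK FN GN invrK => FGxy; ring: FGxy.
Qed.

(** In the equations at [(x, y)] and [(y, x)] the factors [G (x - y)] and [G (y - x)] are mutually
    inverse, so the product retains only [F]. *)
Lemma unit_kac_bernstein_sqrD (K : fieldType) (X : zmodType) (F G : X -> K) :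
  (forall x, G x != 0) -> (forall x, G (- x) = (G x)^-1) ->
  unit_kac_bernstein F G ->
  forall x y, F (x + y) ^+ 2 = F x ^+ 2 * F y ^+ 2.
Proof.
move=> Gn0 GN FG x y.
have Exy := FG x y; have := FG y x; rewrite -opprB GN (addrC y x) => Eyx.
have -> : F (x + y) ^+ 2 =
    (F (x + y) * G (x - y)) * (F (x + y) * (G (x - y))^-1).
  by field.
by rewrite Exy Eyx; field; rewrite !Gn0.
Qed.

(* Apply the equation at [(x + 2y, 2y)]: the factor [G x] cancels, and
   [F (x + 2y) * G (x + 2y)] is known from the two equations at [(x + y, y)]. *)
Lemma unit_kac_bernstein_mul4 (K : fieldType) (X : zmodType) (F G : X -> K) :
  (forall x, F x != 0) -> (forall x, G x != 0) ->
  (forall x, F (- x) = (F x)^-1) -> (forall x, G (- x) = (G x)^-1) ->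
  unit_kac_bernstein F G -> forall x y, F (x + y *+ 4) = F x * F y ^+ 4.
Proof.
move=> Fn0 Gn0 FN GN FG x y.
have GF := unit_kac_bernstein_sym FN GN FG.
have F2 := unit_kac_bernstein_sqrD Gn0 GN FG.
have G2 := unit_kac_bernstein_sqrD Fn0 FN GF.
(* Both values square to [1] and may be [-1]; the equation at [(0, 0)] makes their product [1]. *)
have FG0 : F 0 = G 0.
  apply: (mulIf (Gn0 0)); have := FG 0 0; rewrite subr0 addr0 => FG00.
  have F00 : F 0 ^+ 2 = 1.
    by rewrite expr2 -{2}oppr0 FN mulfV.
  have G00 : G 0 ^+ 2 = 1.
    by rewrite expr2 -{2}oppr0 GN mulfV.
  by rewrite FG00 mulfK // -!expr2 F00 G00.
have FGD z : F (z + y + y) * G (z + y + y) * (F z * G z) =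
    (F z * G z) ^+ 2 * (F y * G y) ^+ 2.
  have := GF (z + y) y; have := FG (z + y) y; rewrite !addrK => E1 E2.
  have -> : F (z + y + y) * G (z + y + y) * (F z * G z) =
     (F (z + y + y) * G z) * (G (z + y + y) * F z) by ring.
  rewrite E1 E2; have := F2 z y; have := G2 z y => e1 e2.
  have -> : (F z * G z) ^+ 2 * (F y * G y) ^+ 2 =
     (F z ^+ 2 * F y ^+ 2) * (G z ^+ 2 * G y ^+ 2) by ring.
  by rewrite -e1 -e2; field; rewrite Fn0 Gn0.
have {}FGD : F (x + y + y) * G (x + y + y) = F x * G x * (F y * G y) ^+ 2.
  have FGn0 : F x * G x != 0 by rewrite mulf_neq0.
  by apply: (mulIf FGn0); rewrite FGD; ring.
have := FG (x + y + y) (y + y).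
rewrite (_ : x + y + y - (y + y) = x); last by rewrite -[x + y + y]addrA addrK.
rewrite (_ : x + y + y + (y + y) = x + y *+ 4); last first.
  by rewrite !mulrS mulr0n addr0 !addrA.
have := GF y y; have := FG y y; rewrite subrr FG0 => Fyy Gyy.
(* The factors [G 0] turn numerator and denominator into the left sides at [(y, y)], equal to
   [F y ^+ 2] and [G y ^+ 2]. *)
have -> : F (x + y + y) * F (y + y) * G (x + y + y) * (G (y + y))^-1 =
    F (x + y + y) * G (x + y + y) * ((F (y + y) * G 0) / (G (y + y) * G 0)).
  by field; rewrite !Gn0.
rewrite Fyy Gyy FGD => E; apply: (mulIf (Gn0 x)); rewrite E.
by field; rewrite Fn0 Gn0.
Qed.

(** The equality of squares is kept in the conclusion because over [R[i]] it yields that [alpha] has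
    modulus one. *)
Lemma character_sign_decomposition (K : fieldType) (X : zmodType)
    (F G : X -> K) :
  (forall x, F x != 0) -> (forall x, G x != 0) ->
  (forall x, F (- x) = (F x)^-1) -> (forall x, G (- x) = (G x)^-1) ->
  unit_kac_bernstein F G ->
  exists alpha a : X -> K,
    [/\ forall x, F x = alpha x * a x,
        forall x y, alpha (x + y) = alpha x * alpha y,
        forall x, alpha x ^+ 2 = F x ^+ 2,
        forall x, a x = 1 \/ a x = -1 &
        constant_on_cosets (multiples X 4) a].
Proof.
move=> Fn0 Gn0 FN GN FG.
have [||alpha [alphaD alpha2]] := @sqrt_character K X F Fn0.
- exact: unit_kac_bernstein_sqrD FG.
- move=> x /eqP; rewrite addr_eq0 => /eqP x_opp.
  by rewrite expr2 {2}x_opp FN mulfV.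
have an0 x : alpha x != 0 by rewrite -sqrf_eq0 alpha2 sqrf_eq0.
exists alpha, (fun x => F x / alpha x); split=> //.
- by move=> x; rewrite mulrC divfK.
- move=> x; have /eqP : (F x / alpha x) ^+ 2 = 1.
    by rewrite expr_div_n alpha2 divff // expf_neq0.
  by rewrite sqrf_eq1 => /orP[] /eqP; [left | right].
(* Fourth powers depend only on squares, where [alpha] and [F] agree. *)
- have alpha4 y : alpha (y *+ 4) = F y ^+ 4.
    rewrite (exprM _ 2 2) -alpha2 -exprM !mulrS mulr0n addr0 !alphaD.
    by ring.
  move=> c x y.
  suff inv z : coset_by (multiples X 4) c z -> F z / alpha z = F c / alpha c.
    by move=> /inv -> /inv ->.
  case=> _ [w _ <-] <-.
  rewrite (unit_kac_bernstein_mul4 Fn0 Gn0 FN GN FG) alphaD alpha4.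
  by field; rewrite an0 Fn0.
Qed.

Lemma hermitian_unit (R : realType) (X : zmodType) (f : X -> R[i]) :
  (forall x, f x != 0) -> hermitian_fun f ->
  forall x, f (- x) / `|f (- x)| = (f x / `|f x|)^-1.
Proof.
move=> fn0 fh x; rewrite fh norm_conjC invf_div.
have nn0 : `|f x| != 0 by rewrite normr_eq0.
by apply/eqP; rewrite eqr_div // -expr2 normCK mulrC.
Qed.

(** The norm on [R[i]] takes values in [R[i]], hence the real part before the real logarithm. *)
Lemma normC_expR_ln (R : realType) (z : R[i]) :
  z != 0 -> `|z| = (expR (ln (complex.Re `|z|)))%:C.
Proof.
move=> zn0; have z_gt0 : 0 < `|z| by rewrite normr_gt0.
have zE : `|z| = (complex.Re `|z|)%:C by apply/esym/RRe_real/gtr0_real.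
by rewrite lnK ?posrE // -ltcR -zE.
Qed.

Theorem theorem3p1 (R : realType) (X : zmodType) (f g : X -> R[i])
    (f_neq0 : forall x : X, f x != 0) (g_neq0 : forall x : X, g x != 0)
    (f_herm : hermitian_fun f) (g_herm : hermitian_fun g)
    (fg_kb : kac_bernstein f g) :
  exists (alpha beta a b : X -> R[i]) (P r : X -> R),
    [/\ forall x : X, f x = alpha x * a x * (expR (P x + r x))%:C /\
                      g x = beta x * b x * (expR (P x - r x))%:C,
        (forall x y : X, alpha (x + y) = alpha x * alpha y /\
                         beta (x + y) = beta x * beta y) /\
        (forall x : X, `|alpha x| = 1 /\ `|beta x| = 1),
        (forall x : X, (a x = 1 \/ a x = -1) /\ (b x = 1 \/ b x = -1)) /\
        (constant_on_cosets (multiples X 4) a /\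
         constant_on_cosets (multiples X 4) b),
        forall x y : X, P (x + y) + P (x - y) = 2 * (P x + P y) &
        constant_on_cosets (multiples X 2) r].
Proof.
pose F x := f x / `|f x|; pose G x := g x / `|g x|.
have nf x : `|f x| != 0 by rewrite normr_eq0.
have ng x : `|g x| != 0 by rewrite normr_eq0.
have Fn0 x : F x != 0 by rewrite mulf_neq0 ?invr_eq0.
have Gn0 x : G x != 0 by rewrite mulf_neq0 ?invr_eq0.
have FN x : F (- x) = (F x)^-1 by exact: hermitian_unit.
have GN x : G (- x) = (G x)^-1 by exact: hermitian_unit.
have FG : unit_kac_bernstein F G.
  move=> x y; rewrite -GN /F /G.
  by rewrite mulrACA -invfM -normrM fg_kb !normrM; field; rewrite !nf !ng.
have GF := unit_kac_bernstein_sym FN GN FG.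
have [alpha [a [Fa alphaD alpha2 a1 a4]]] :=
  character_sign_decomposition Fn0 Gn0 FN GN FG.
have [beta [b [Gb betaD beta2 b1 b4]]] :=
  character_sign_decomposition Gn0 Fn0 GN FN GF.
have unit_norm (u h : X -> R[i]) x : `|h x| != 0 ->
    u x ^+ 2 = (h x / `|h x|) ^+ 2 -> `|u x| = 1.
  move=> hn0 /(congr1 Num.norm); rewrite !normrX normf_div normr_id divff //.
  by rewrite expr1n => /eqP; rewrite sqrp_eq1 // => /eqP.
pose phi x := ln (complex.Re `|f x|); pose psi x := ln (complex.Re `|g x|).
have fE x : `|f x| = (expR (phi x))%:C by exact: normC_expR_ln.
have gE x : `|g x| = (expR (psi x))%:C by exact: normC_expR_ln.
have psiN x : psi (- x) = psi x by rewrite /psi g_herm norm_conjC.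
have phiN x : phi (- x) = phi x by rewrite /phi f_herm norm_conjC.
have phipsi x y : phi (x + y) + psi (x - y) = phi x + phi y + psi x + psi y.
  have := congr1 Num.norm (fg_kb x y).
  rewrite !normrM !fE !gE -!rmorphM -!expRD => /complexI /expR_inj.
  by rewrite psiN.
have psiphi x y : psi (x + y) + phi (x - y) = phi x + phi y + psi x + psi y.
  by have := phipsi x (- y); rewrite opprK phiN psiN addrC.
(* Half-sum and half-difference, so that [P + r = phi] and [P - r = psi]. *)
exists alpha, beta, a, b, (fun x => (phi x + psi x) / 2),
  (fun x => (phi x - psi x) / 2).
split=> [x|||x y|c].
- have -> : (phi x + psi x) / 2 + (phi x - psi x) / 2 = phi x by field.
  have -> : (phi x + psi x) / 2 - (phi x - psi x) / 2 = psi x by field.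
  by rewrite -Fa -Gb -fE -gE !divfK.
- by split=> [x y|x]; split=> //; [exact: (unit_norm _ f) | exact: (unit_norm _ g)].
- by split=> // x; split.
- have E1 := phipsi x y; have E2 := psiphi x y.
  have -> : (phi (x + y) + psi (x + y)) / 2 + (phi (x - y) + psi (x - y)) / 2
    = ((phi (x + y) + psi (x - y)) + (psi (x + y) + phi (x - y))) / 2 by ring.
  by rewrite E1 E2; field.
- suff inv z : coset_by (multiples X 2) c z ->
      (phi z - psi z) / 2 = (phi c - psi c) / 2.
    by move=> x y /inv -> /inv ->.
  case=> _ [w _ <-] <-; congr (_ / 2).
  (* At [(c + w, w)] the two equations share their right side; equating the left sides compares
     [phi - psi] at [c + 2w] and at [c]. *)
  have := phipsi (c + w) w; rewrite -(psiphi (c + w) w) addrK mulr2n addrA.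
  by move=> E; lra.
Qed.
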